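(* Let $\mathcal{G}$ be a bipartite graph with $s$ edges (not necessarily connected), and let $X$ be the algebraic toric set associated to $\mathcal{G}$ over $K=\mathbb{F}_q$. Let $\mathcal{H}_1,\dots,\mathcal{H}_m$ be subgraphs of $\mathcal{G}$ isomorphic to (even) cycles $\mathcal{H}_i\cong\mathcal{C}_{2k_i}$ that have (pairwise) disjoint edge sets. Then $$\operatorname{reg} S/I(X)\leq (q-2)\Big(s-\sum_{i=1}^m k_i-1\Big).$$
   Context: $K=\mathbb{F}_q$ is a finite field with $q>2$ elements, $K^*=K\setminus\{0\}$, and $\mathbb{P}^{s-1}$ is the projective space of dimension $s-1$ over $K$. Graphs are simple, without isolated vertices and with at least two edges; $\mathcal{C}_{2k}$ denotes the cycle with $2k$ vertices. For a graph $\mathcal{G}$ with vertices $v_1,\dots,v_n$ and edges $e_1,\dots,e_s$, for $\mathbf{x}\in(K^* )^n$ and $e_i=\{v_j,v_l\}$ put $\mathbf{x}^{e_i}=x_jx_l$. The algebraic toric set associated to $\mathcal{G}$ is $X=\{[(\mathbf{x}^{e_1},\dots,\mathbf{x}^{e_s})]:\mathbf{x}\in(K^* )^n\}\subset\mathbb{P}^{s-1}$, and $I(X)\subset S=K[t_1,\dots,t_s]$ (standard grading) is the ideal generated by the homogeneous polynomials vanishing on $X$. The Hilbert function is $H_X(d)=\dim_K(S/I(X))_d$; the Hilbert polynomial $h_X$ of $S/I(X)$ is the constant $|X|$. The regularity $\operatorname{reg} S/I(X)$ is the least integer $\ell\ge0$ such that $H_X(d)=h_X(d)$ for all $d\ge\ell$.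 The $\mathcal{H}_i$ need not be all the cycles of $\mathcal{G}$. *)

(* Defs.v *)
From HB Require Import structures.
From mathcomp Require Import all_boot all_order all_algebra.
From mathcomp Require Import mpoly.
From mathcomp Require boolp.

Set Implicit Arguments.
Unset Strict Implicit.
Unset Printing Implicit Defensive.

Import GRing.Theory.
Local Open Scope ring_scope.

Record sgraph := SGraph {
  svert :> finType;
  adj : rel svert;
  adj_sym : ssrbool.symmetric adj;
  adj_irrefl : irreflexive adj }.

Definition edges (G : sgraph) : {set {set G}} :=
  [set e | [exists x : G, exists y : G, adj x y && (e == [set x; y])]].

Definition no_isolated_vertex (G : sgraph) : Prop :=
  forall x : G, exists y : G, adj x y.

Definition bipartite (G : sgraph) : Prop :=
  exists side : G -> bool, forall x y : G, adj x y -> side x != side y.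

Definition sgraph_iso (G H : sgraph) : Prop :=
  exists2 f : G -> H, bijective f & forall x y, adj (f x) (f y) = adj x y.

Lemma edges_set2 (G : sgraph) (x y : G) : ([set x; y] \in edges G) = adj x y.
Proof.
rewrite inE; apply/existsP/idP => [[a /existsP[b /andP[ab /eqP eq_ab]]]|xy].
  have nab : a != b by apply: contraTneq ab => ->; rewrite adj_irrefl.
  have : a \in [set x; y] by rewrite eq_ab set21.
  have : b \in [set x; y] by rewrite eq_ab set22.
  rewrite !inE => /orP[] /eqP eb /orP[] /eqP ea; move: ab nab;
    by rewrite ea eb ?eqxx // adj_sym.
by exists x; apply/existsP; exists y; rewrite xy eqxx.
Qed.

(* Meant for n >= 3; the conjunct [i != j] only makes the relation
   irreflexive when n = 1. For n = 2 it is a single edge, not a cycle. *)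
Definition cycle_adj (n : nat) : rel 'I_n :=
  fun i j => (i != j) && ((j == i.+1 %% n :> nat) || (i == j.+1 %% n :> nat))%N.

Lemma cycle_adj_sym n : ssrbool.symmetric (@cycle_adj n).
Proof. by move=> i j; rewrite /cycle_adj eq_sym orbC. Qed.

Lemma cycle_adj_irrefl n : irreflexive (@cycle_adj n).
Proof. by move=> i; rewrite /cycle_adj eqxx. Qed.

Definition cycle_graph (n : nat) : sgraph :=
  SGraph (@cycle_adj_sym n) (@cycle_adj_irrefl n).

(* Not necessarily induced. *)
Record subgraph (G : sgraph) := Subgraph {
  sub_verts : {set G};
  sub_edges : {set {set G}};
  sub_edges_edges : sub_edges \subset edges G;
  sub_edges_verts : forall e, e \in sub_edges -> e \subset sub_verts }.

Section SubgraphAsGraph.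
Variables (G : sgraph) (H : subgraph G).

Definition sub_adj : rel {x : G | x \in sub_verts H} :=
  fun x y => [set val x; val y] \in sub_edges H.

Lemma sub_adj_sym : ssrbool.symmetric sub_adj.
Proof. by move=> x y; rewrite /sub_adj setUC. Qed.

Lemma sub_adj_irrefl : irreflexive sub_adj.
Proof.
move=> x; apply/negP => /(subsetP (sub_edges_edges H)).
by rewrite edges_set2 adj_irrefl.
Qed.

Definition graph_of_subgraph : sgraph := SGraph sub_adj_sym sub_adj_irrefl.

End SubgraphAsGraph.

Coercion graph_of_subgraph : subgraph >-> sgraph.

(* A numbering e_1, ..., e_s of the edges; s is then the number of edges. *)
Definition edge_numbering (G : sgraph) (s : nat) (e : 'I_s -> {set G}) : Prop :=
  injective e /\ [set e i | i : 'I_s] = edges G.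

Section ProjectiveSets.
Variables (K : finFieldType) (s : nat).

(* The point [v] of P^(s-1) is the set of all nonzero multiples of v != 0. *)
Definition proj_point (v : 'rV[K]_s) : {set 'rV[K]_s} :=
  [set w | [exists c : K, (c != 0) && (w == c *: v)]].

Definition proj_space : {set {set 'rV[K]_s}} :=
  [set proj_point v | v : 'rV[K]_s & v != 0].

Definition vanishes_on (X : {set {set 'rV[K]_s}}) (f : {mpoly K[s]}) : Prop :=
  forall P, P \in X -> forall v, v \in P -> f.@[v 0] = 0.

Definition ideal_generated (A : {mpoly K[s]} -> Prop) (f : {mpoly K[s]}) :
  Prop :=
  exists r (a g : 'I_r -> {mpoly K[s]}),
    (forall i, A (g i)) /\ f = \sum_i a i * g i.

Definition vanishing_ideal (X : {set {set 'rV[K]_s}}) : {mpoly K[s]} -> Prop :=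
  ideal_generated
    (fun g => (exists d, g \is d.-homog) /\ vanishes_on X g).

Lemma ideal_generated0 A : ideal_generated A 0.
Proof.
exists 0%N, (fun=> 0), (fun=> 0).
by split=> [[]//|]; rewrite big_ord0.
Qed.

Lemma ideal_generatedD A f g :
  ideal_generated A f -> ideal_generated A g -> ideal_generated A (f + g).
Proof.
move=> [r [a [u [Au ->]]]] [t [b [v [Av ->]]]].
exists (r + t)%N.
exists (fun i => match split i with inl j => a j | inr j => b j end).
exists (fun i => match split i with inl j => u j | inr j => v j end).
split=> [i|]; first by case: (split i).
rewrite big_split_ord /=; congr (_ + _); apply: eq_bigr => i _.
  by have -> : split (lshift t i) = inl i := unsplitK (inl i).
by have -> : split (rshift r i) = inr i := unsplitK (inr i).
Qed.

Lemma ideal_generatedM A f h :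
  ideal_generated A f -> ideal_generated A (h * f).
Proof.
move=> [r [a [u [Au ->]]]]; exists r, (fun i => h * a i), u; split=> //.
by rewrite mulr_sumr; apply: eq_bigr => i _; rewrite mulrA.
Qed.

End ProjectiveSets.

(* The library makes [dhomog n R d] a vector space only for n of the form
   n'.+1; the following copy also covers n = 0. *)
Definition graded_piece (K : fieldType) (s d : nat) := dhomog s K d.

HB.instance Definition _ (K : fieldType) (s d : nat) :=
  GRing.Lmodule.copy (graded_piece K s d) (dhomog s K d).

Definition graded_piece_dim (s d : nat) : nat :=
  if s is n.+1 then 'C(d + n, d) else (d == 0%N).

Lemma graded_piece_vecaxiom (K : fieldType) (s d : nat) :
  Vector.axiom (graded_piece_dim s d) (graded_piece K s d).
Proof.
case: s => [|n]; last exact: dhomog_vecaxiom.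
pose f (p : graded_piece K 0 d) : 'rV[K]_(graded_piece_dim 0 d) :=
  \row__ (p : {mpoly K[0]})@_0%MM.
exists f => [c p q|]; first by apply/rowP=> i; rewrite !mxE mcoeffD mcoeffZ.
have m0 (m : 'X_{1..0}) : m = 0%MM by apply/mnmP; case.
have hom r : (r : K) *: (1 : {mpoly K[0]}) \is 0.-homog.
  by rewrite rpredZ ?dhomog1.
case: d @f => [|d] f.
  exists (fun r : 'rV_1 => DHomog (hom (r 0 0))) => [p|r].
    by apply/val_inj/mpolyP => m /=;
      rewrite (m0 m) mxE mcoeffZ mcoeff1 eqxx mulr1.
  by apply/rowP=> i; rewrite mxE /= mcoeffZ mcoeff1 eqxx mulr1 ord1.
exists (fun=> 0) => [p|r]; last by apply/rowP; case.
apply/val_inj/mpolyP => m /=; rewrite (m0 m) mcoeff0.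
by rewrite (dhomog_nemf_coeff (dhomog_is_dhomog p)) // mf0.
Qed.

HB.instance Definition _ (K : fieldType) (s d : nat) :=
  Lmodule_hasFinDim.Build K (graded_piece K s d)
    (graded_piece_vecaxiom K s d).

Lemma linear_closed_vspace (K : fieldType) (vT : vectType K) (P : vT -> Prop) :
  P 0 -> (forall a u v, P u -> P v -> P (a *: u + v)) ->
  exists U : {vspace vT}, forall v, v \in U <-> P v.
Proof.
move=> P0 Plin.
pose good n := exists2 U : {vspace vT}, \dim U = n & forall v, v \in U -> P v.
have ex_good : exists n, boolp.asbool (good n).
  exists 0%N; apply/boolp.asboolP; exists 0%VS; first exact: dimv0.
  by move=> v; rewrite memv0 => /eqP ->.
have le_good n : boolp.asbool (good n) -> (n <= \dim {:vT})%N.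
  by move/boolp.asboolP=> [U <- _]; apply: dimvS (subvf U).
case: (ex_maxnP ex_good le_good) => n /boolp.asboolP[U dimU UP] max_n.
exists U => v; split=> [/UP//|Pv].
have goodW : good (\dim (<[v]> + U)%VS).
  exists (<[v]> + U)%VS => // _ /memv_addP[_ /vlineP[c ->] [u Uu ->]].
  exact/Plin/UP.
have := max_n _ (introT (boolp.asboolP _) goodW).
rewrite -dimU => le_dim.
suff -> : U = (<[v]> + U)%VS.
  by apply: (subvP (addvSl _ _)); exact: memv_line.
by apply/eqP; rewrite eqEdim addvSr le_dim.
Qed.

Section HilbertFunction.
Variables (K : finFieldType) (s : nat) (X : {set {set 'rV[K]_s}}).

Lemma vanishing_ideal_piece_ex (d : nat) :
  exists U : {vspace graded_piece K s d},
    forall f, f \in U <-> vanishing_ideal X (mpoly_of_dhomog f).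
Proof.
apply: linear_closed_vspace => [|c f g If Ig]; first exact: ideal_generated0.
apply: ideal_generatedD => //; rewrite -[X in ideal_generated _ X]mul_mpolyC.
exact: ideal_generatedM.
Qed.

(* I(X)_d as a subspace of S_d *)
Definition vanishing_ideal_piece (d : nat) : {vspace graded_piece K s d} :=
  projT1 (boolp.constructive_indefinite_description
            (vanishing_ideal_piece_ex d)).

Lemma vanishing_ideal_pieceP (d : nat) (f : graded_piece K s d) :
  f \in vanishing_ideal_piece d <-> vanishing_ideal X (mpoly_of_dhomog f).
Proof.
by rewrite /vanishing_ideal_piece;
  case: boolp.constructive_indefinite_description.
Qed.

(* dim (S/I(X))_d, where (S/I(X))_d = S_d / I(X)_d *)
Definition hilbert_function (d : nat) : nat :=
  (\dim {: graded_piece K s d} - \dim (vanishing_ideal_piece d))%N.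

(* S/I(X) has dimension 1 and degree #|X|, so its Hilbert polynomial is
   constant. *)
Definition hilbert_polynomial (d : nat) : nat := #|X|.

Definition agrees_from (l : nat) : Prop :=
  forall d, (l <= d)%N -> hilbert_function d = hilbert_polynomial d.

Definition is_regularity (l : nat) : Prop :=
  agrees_from l /\ forall l', agrees_from l' -> (l <= l')%N.

End HilbertFunction.

Section ToricSet.
Variables (K : finFieldType) (G : sgraph) (s : nat) (e : 'I_s -> {set G}).

Definition edge_monomial_vector (x : {ffun G -> K}) : 'rV[K]_s :=
  \row_i \prod_(v in e i) x v.

Definition toric_set : {set {set 'rV[K]_s}} :=
  [set proj_point (edge_monomial_vector x)
    | x : {ffun G -> K} & [forall v, x v != 0]].

Lemma toric_set_sub : (0 < s)%N -> toric_set \subset proj_space K s.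
Proof.
move=> s_gt0; apply/subsetP => _ /imsetP[x /[!inE] /forallP nzx ->].
apply/imsetP; exists (edge_monomial_vector x) => //; rewrite inE.
apply/eqP => /rowP/(_ (Ordinal s_gt0)) /[!mxE] /eqP.
by apply/negP/prodf_neq0 => v _; apply: nzx.
Qed.

End ToricSet.

(* Main.v *)
(** Let q = #|K| and fix any edge e_0.  On X, forms of degree d take the values
    v_0^d w^b with w = v/v_0 and sum_(i != 0) b_i <= d, so it suffices to
    rewrite every monomial in w as some w^b with
    sum_(i != 0) b_i <= (q-2)(s - sum k_i - 1): then all polynomial functions of
    w, in particular indicators of points, come from forms of degree d, and the
    Hilbert function at d is |X|.  Exponents live in Z/(q-1).  The two
    alternating classes of edges of an even cycle have the same product, so c
    may be added to the exponents on one class and subtracted on the other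
    without changing the value.  Averaging over c brings the total on a cycle
    of length 2k down to (q-2)k, and a sharper form of the averaging still
    gains the full q-2 at e_0 when e_0 lies on the cycle. *)
Require Import Defs.
From HB Require Import structures.
From mathcomp Require Import all_boot all_order all_algebra all_field.
From mathcomp Require Import mpoly zify.
From mathcomp Require boolp.

Set Implicit Arguments.
Unset Strict Implicit.
Unset Printing Implicit Defensive.

Import GRing.Theory.

(** * Reducing exponents modulo q - 1 along edge-disjoint cycles *)

Section ExponentReduction.
Local Open Scope ring_scope.

Lemma sum_ord_perm M (f : 'I_M.+1 -> 'I_M.+1) :
  injective f -> ((\sum_c f c).*2 = M.+1 * M)%N.
Proof.
move=> f_inj.
have <- : (\sum_(c < M.+1) c = \sum_c f c)%N by rewrite (reindex_inj f_inj).
rewrite -(big_mkord xpredT id) bin2_sum bin2.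
by rewrite -[LHS]add0n -[X in (X + _)%N](_ : odd (M.+1 * M) = 0%N :> nat)
  ?odd_double_half // oddM /= andNb.
Qed.

(** With M = q - 2, addition in ['I_M.+1] is that of Z/(q-1). Only the entries on a cycle [P :|: Q]
    matter later. *)
Definition alternating_shift M (I : finType) (P : {set I})
    (a : I -> 'I_M.+1) (c : 'I_M.+1) (i : I) : 'I_M.+1 :=
  if i \in P then a i + c else a i - c.

Section AlternatingShift.
Variables (M : nat) (I : finType) (a : I -> 'I_M.+1) (P Q : {set I}) (k : nat).
Hypotheses (disjPQ : [disjoint P & Q]) (cardP : #|P| = k) (cardQ : #|Q| = k).

Let shift := alternating_shift P a.

Let shift_inj i : injective (shift^~ i).
Proof.
by move=> c c'; rewrite /shift /alternating_shift; case: ifP => _ /addrI // /oppr_inj.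
Qed.

Let S c := (\sum_(i in P :|: Q) shift c i)%N.

Let cardPQ : #|P :|: Q| = (k + k)%N.
Proof. by rewrite cardsU disjoint_setI0 // cards0 subn0 cardP cardQ. Qed.

(** As c varies, each of the 2k entries takes every value from 0 to M once, so [S] averages k *
    M. *)
Let sum_S : (\sum_c S c = k * (M.+1 * M))%N.
Proof.
apply: double_inj; rewrite exchange_big /= -mul2n big_distrr /=.
under eq_bigr => i _ do rewrite mul2n (sum_ord_perm (@shift_inj i)).
by rewrite sum_nat_const cardPQ -addnn mulnDl.
Qed.

Let S_mod c : S c = \sum_(i in P :|: Q) a i %[mod M.+1].
Proof.
(* Natural representatives of c and -c; they sum to a multiple of [M.+1] because [P] and [Q] have
   equal size. *)
pose t i := if i \in P then c : nat else (M.+1 - c)%N.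
have shiftE i : shift c i = ((a i + t i) %% M.+1)%N :> nat.
  by rewrite /shift /alternating_shift /t; case: ifP => //= _; rewrite modnDmr.
rewrite /S; under eq_bigr => i _ do rewrite shiftE.
rewrite modn_summ big_split /= -modnDmr.
have -> : (\sum_(i in P :|: Q) t i = k * M.+1)%N.
  rewrite (eq_bigl [predU P & Q]) => [|i]; last by rewrite !inE.
  rewrite bigU //= (eq_bigr (fun=> c : nat)) /t => [|i ->//].
  rewrite [X in (_ + X)%N](eq_bigr (fun=> M.+1 - c)%N) => [|i iQ].
    by rewrite !sum_nat_const cardP cardQ -mulnDr subnKC // ltnW.
  by rewrite (disjointFl disjPQ iQ).
by rewrite modnMl addn0.
Qed.

(* The sums [S c] average [k * M] and agree modulo [M.+1], so they exceed their
   minimum by at least [M.+1] off the set [Z] where it is attained.  The entry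
   at [i0] takes [#|Z|] distinct values on [Z], hence one of size at least
   [#|Z|.-1], which is enough to pay for replacing it by [M]. *)
Lemma alternating_shift_bound (i0 : I) :
  exists c : 'I_M.+1,
    (\sum_(i in P :|: Q) (if i == i0 then M else alternating_shift P a c i)
       <= k * M)%N.
Proof.
case: (arg_minnP S (erefl : xpredT (0 : 'I_M.+1))) => c0 _ minS.
pose Z := [set c | S c == S c0].
have Z_gt0 : (0 < #|Z|)%N by apply/card_gt0P; exists c0; rewrite inE.
have Z_le : (#|Z| <= M.+1)%N by rewrite -[leqRHS]card_ord max_card.
have boundS : (S c0 + (M.+1 - #|Z|) <= k * M)%N.
  have lbS c : (S c0 + (c \notin Z) * M.+1 <= S c)%N.
    rewrite inE; have [->|neS] := eqVneq; first by rewrite addn0.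
    have [/eqP eqd ltS] : S c == S c0 %[mod M.+1] /\ (S c0 < S c)%N.
      by rewrite !S_mod eqxx ltn_neqAle eq_sym neS minS.
    have /dvdnP[[|d] dE] : (M.+1 %| S c - S c0)%N by rewrite -eqn_mod_dvd ?eqd ?minS.
      by lia.
    by rewrite /= mul1n; nia.
  have : (\sum_(c < M.+1) (S c0 + (c \notin Z) * M.+1) <= k * (M.+1 * M))%N.
    by rewrite -sum_S leq_sum.
  rewrite big_split /= sum_nat_const card_ord -big_distrl /=.
  have -> : (\sum_(c < M.+1) (c \notin Z) = M.+1 - #|Z|)%N.
    have := cardsC Z; rewrite -big_mkcond card_ord /= => cardZC.
    rewrite -[RHS](_ : #|~: Z| = _); last by apply: (canRL (addnK _)); rewrite addnC.
    by rewrite -sum1_card; apply: eq_bigl => c; rewrite [RHS]inE.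
  by rewrite mulnCA [X in (_ + X)%N]mulnC -mulnDr leq_pmul2l.
have [i0C|i0C] := boolP (i0 \in P :|: Q); last first.
  exists c0; rewrite (eq_bigr (fun i => shift c0 i : nat)).
    by rewrite -/(S c0); lia.
  by move=> i iC; have [eq_i|//] := eqVneq i i0; rewrite -eq_i iC in i0C.
have [c cZ le_c] : exists2 c, c \in Z & (#|Z|.-1 <= shift c i0)%N.
  (* Otherwise [#|Z|] distinct values would all lie below [#|Z|.-1]. *)
  apply/exists_inP; apply: contraT; rewrite negb_exists_in => /forall_inP small.
  have uniq_s : uniq [seq val (shift c i0) | c <- enum Z].
    by rewrite map_inj_uniq ?enum_uniq => // c c' /val_inj /shift_inj.
  have := @uniq_leq_size _ _ (iota 0 #|Z|.-1) uniq_s.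
  rewrite size_map size_iota -cardE leqNgt prednK // leqnn; apply.
  by move=> _ /mapP[c + ->]; rewrite mem_enum mem_iota ltnNge => /small.
exists c; rewrite (bigD1 i0) //= eqxx.
rewrite (eq_bigr (fun i => shift c i : nat)) => [|i /andP[_ /negPf ->]//].
have : S c = S c0 by apply/eqP; rewrite inE in cZ.
rewrite {1}/S (bigD1 i0) //=; lia.
Qed.

End AlternatingShift.

Section CombinedShift.
Variables (M : nat) (I : finType) (m : nat) (P Q : 'I_m -> {set I}).
Variable (k : 'I_m -> nat).
Hypotheses (disjPQ : forall j, [disjoint P j & Q j]).
Hypotheses (cardP : forall j, #|P j| = k j) (cardQ : forall j, #|Q j| = k j).
Hypothesis (disjC : forall j j', j != j' ->
  [disjoint P j :|: Q j & P j' :|: Q j']).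

Let U := \bigcup_j (P j :|: Q j).

Let cardU : (#|U| = (\sum_j k j).*2)%N.
Proof.
rewrite -sum1_card partition_disjoint_bigcup //= -addnn -big_split.
apply: eq_bigr => j _; rewrite sum1_card cardsU disjoint_setI0 //.
by rewrite cards0 subn0 cardP cardQ.
Qed.

(** Keeps the truncated subtraction of [\sum_j k j] exact. *)
Lemma cycles_card_le : ((\sum_j k j).*2 <= #|I|)%N.
Proof. by rewrite -cardU max_card. Qed.

(** Disjoint cycles can be shifted independently, and entries off the cycles are at most M. The
    summand M stands for the entry at [i0], which is discarded when dividing by the coordinate [i0].
    As [b] is chosen before [w], one exponent serves all points. *)
Lemma exponent_reduction (a : I -> 'I_M.+1) (i0 : I) :
  exists2 b : I -> 'I_M.+1,
    (\sum_(i | i != i0) b i + M <= (#|I| - \sum_j k j) * M)%N &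
    forall (F : fieldType) (w : I -> F), (forall i, w i ^+ M.+1 = 1) ->
      (forall j, \prod_(i in P j) w i = \prod_(i in Q j) w i) ->
      \prod_i w i ^+ b i = \prod_i w i ^+ a i.
Proof.
have [c c_bound] := fin_all_exists (fun j =>
  alternating_shift_bound a (disjPQ j) (cardP j) (cardQ j) i0).
pose t j i : 'I_M.+1 := if i \in P j then c j else if i \in Q j then - c j else 0.
pose b i := a i + \sum_j t j i.
have bE j i : i \in P j :|: Q j -> b i = alternating_shift (P j) a (c j) i.
  move=> iC; rewrite /b (bigD1 j) //= big1 ?addr0 => [|j' nej].
    by move: iC; rewrite /t /alternating_shift inE; case: ifP => //= _ ->.
  have := disjointFr (disjC nej); rewrite /t => /(_ i) disj_i.
  case: ifP => iP; first by move: iC; rewrite disj_i // inE iP.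
  by case: ifP => iQ //; move: iC; rewrite disj_i // inE iQ orbT.
exists b => [|F w w_unit w_cycle].
  pose b' i := if i == i0 then M else b i.
  have -> : (\sum_(i | i != i0) b i + M = \sum_i b' i)%N.
    rewrite [RHS](bigD1 i0) //= /b' eqxx addnC; congr (_ + _)%N.
    by apply: eq_bigr => i /negPf ->.
  rewrite (bigID (mem U)) /= partition_disjoint_bigcup //=.
  have le_in : (\sum_j \sum_(i in P j :|: Q j) b' i <= (\sum_j k j) * M)%N.
    rewrite big_distrl leq_sum //= => j _; apply: leq_trans (c_bound j).
    by apply/eq_leq/eq_bigr => i iC; rewrite /b' (bE j).
  have le_out : (\sum_(i | i \notin U) b' i <= (#|I| - #|U|) * M)%N.
    rewrite -(cardsC U) addKn -sum_nat_const big_mkcond [leqRHS]big_mkcond.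
    apply: leq_sum => i _; rewrite inE /b'; case: (i \in U) => //=.
    by case: eqP => //= _; rewrite -ltnS ltn_pmod.
  (* In units of M, the cycles give n, the sum of the [k j], and the remaining [#|I|] - 2n entries
     one each. *)
  apply: leq_trans (leq_add le_in le_out) _; rewrite -mulnDl leq_mul // cardU.
  have arith (x y : nat) : (x.*2 <= y -> x + (y - x.*2) <= y - x)%N by lia.
  exact: arith cycles_card_le.
have expD (z : F) (x y : 'I_M.+1) : z ^+ M.+1 = 1 ->
    z ^+ (x + y)%R = z ^+ x * z ^+ y.
  by move=> z_unit; rewrite /= expr_mod // exprD.
have exp_sum i : w i ^+ (\sum_j t j i)%R = \prod_j w i ^+ t j i.
  by apply: (big_morph (fun x : 'I_M.+1 => w i ^+ x)) => // x y; apply: expD.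
under eq_bigr => i _ do rewrite expD // exp_sum.
rewrite big_split /= exchange_big /= [X in _ * X]big1 ?mulr1 // => j _.
rewrite (bigID (mem (P j))) /= (eq_bigr (fun i => w i ^+ c j)) => [|i iP]; last first.
  by rewrite /t iP.
rewrite [X in _ * X](bigID (mem (Q j))) /= [X in _ * (_ * X)]big1 => [|i]; last first.
  by rewrite /t => /andP[/negPf -> /negPf ->].
rewrite mulr1 [X in _ * X](eq_bigl (fun i => i \in Q j)) => [|i]; last first.
  have [iQ|] := boolP (i \in Q j); last by rewrite andbF.
  by rewrite (disjointFl (disjPQ j)).
rewrite [X in _ * X](eq_bigr (fun i => w i ^+ (- c j))) => [|i iQ]; last first.
  by rewrite /t iQ (disjointFl (disjPQ j)).
(* Cycle j contributes p^(c j) * p^(- c j) = 1, p being the common product over its two classes. *)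
rewrite !prodrXl w_cycle -expD ?subrr // -prodrXl big1 // => i _.
Qed.

End CombinedShift.
End ExponentReduction.

(** * Hilbert function of points separated by forms *)

Section Separation.
Local Open Scope ring_scope.
Variables (K : finFieldType) (s : nat).

Lemma meval_homog_scale d (f : {mpoly K[s]}) c (v : 'rV[K]_s) :
  f \is d.-homog -> f.@[(c *: v) 0] = c ^+ d * f.@[v 0].
Proof.
move=> /dhomogP homf; rewrite !mevalE mulr_sumr; apply: eq_big_seq => a /homf <-.
rewrite mulrCA; congr (_ * _); rewrite /= mdegE -prodrXr -big_split /=.
by apply: eq_bigr => i _; rewrite mxE exprMn.
Qed.

Lemma proj_pointZ c (v : 'rV[K]_s) :
  c != 0 -> proj_point (c *: v) = proj_point v.
Proof.
move=> c_neq0; apply/setP => w; rewrite !inE.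
apply/existsP/existsP => -[b /andP[b_neq0 /eqP ->]].
  by exists (b * c); rewrite mulf_neq0 //= scalerA.
by exists (b / c); rewrite mulf_neq0 ?invr_neq0 //= scalerA divfK.
Qed.

(** Several vectors of [A] may represent one point, so [f] has to single out only the point, not the
    vector. *)
Definition separated_by_forms (A : {set 'rV[K]_s}) d :=
  forall v, v \in A -> exists2 f : {mpoly K[s]}, f \is d.-homog &
    f.@[v 0] != 0 /\
    forall u, u \in A -> f.@[u 0] != 0 -> proj_point u = proj_point v.

Definition eval_at n (r : 'I_n -> 'rV[K]_s) d (f : graded_piece K s d) :
  'rV[K]_n := \row_j (mpoly_of_dhomog f).@[r j 0].

Lemma eval_at_linear n r d : linear (@eval_at n r d).
Proof. by move=> c f g; apply/rowP => j; rewrite !mxE mevalD mevalZ. Qed.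

HB.instance Definition _ n r d :=
  GRing.isLinear.Build K (graded_piece K s d) 'rV[K]_n _ (@eval_at n r d)
    (eval_at_linear r (d := d)).

(** Evaluating forms of degree d at one representative of each point is a linear map with kernel
    I(X)_d; separation makes it onto, and rank-nullity concludes. *)
Lemma hilbert_function_separated (A : {set 'rV[K]_s}) d :
  separated_by_forms A d ->
  hilbert_function [set proj_point v | v in A] d =
    #|[set proj_point v | v in A]|.
Proof.
set X := [set proj_point v | v in A] => sepA.
have repX (j : 'I_#|X|) : exists2 v, v \in A & proj_point v = enum_val j.
  by have /imsetP[v vA ->] := enum_valP j; exists v.
have [r rA rE] := fin_all_exists2 repX.
pose ev := linfun (eval_at r (d := d)).
have evE f j : ev f 0 j = (mpoly_of_dhomog f).@[r j 0] by rewrite lfunE mxE.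
have vanishX (f : graded_piece K s d) :
    vanishes_on X (mpoly_of_dhomog f) <-> f \in lker ev.
  rewrite memv_ker; split=> [fX|/eqP evf0].
    apply/eqP/rowP => j; rewrite evE mxE; apply: (fX (enum_val j)).
      exact: enum_valP.
    by rewrite -rE inE; apply/existsP; exists 1; rewrite oner_neq0 scale1r eqxx.
  move=> p pX v; rewrite -(enum_rankK_in pX pX) -rE inE => /existsP[c].
  case/andP => _ /eqP ->; rewrite (meval_homog_scale _ _ (dhomog_is_dhomog f)).
  by rewrite -evE evf0 mxE mulr0.
(* Elements of the ideal vanish as combinations of vanishing generators; a vanishing form of degree
   d is itself a generator. *)
have kerE : vanishing_ideal_piece X d = lker ev.
  apply/vspaceP => f; apply/idP/idP => [/vanishing_ideal_pieceP|].
    move=> [n [a [g [gX fE]]]]; apply/vanishX => p pX v vp.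
    rewrite fE raddf_sum big1 // => i _.
    by rewrite /= mevalM (proj2 (gX i) _ pX _ vp) mulr0.
  move/vanishX => fX; apply/vanishing_ideal_pieceP.
  exists 1%N, (fun=> 1), (fun=> mpoly_of_dhomog f); split=> [_|].
    by split=> //; exists d; apply: dhomog_is_dhomog.
  by rewrite big_ord1 mul1r.
have ev_full : limg ev = fullv.
  apply/eqP; rewrite eqEsubv subvf; apply/subvP => y _.
  rewrite (row_sum_delta y) memv_suml // => j _; apply: memvZ.
  have [f f_homog [fj_neq0 f_sep]] := sepA _ (rA j).
  (* A separating form is sent to a nonzero multiple of a basis vector. *)
  have fE : ev (DHomog f_homog) = f.@[r j 0] *: delta_mx 0 j.
    apply/rowP => i; rewrite evE !mxE eqxx /=; case: eqP => [->|ne_ij].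
      by rewrite mulr1.
    rewrite mulr0; apply/eqP; apply: contraT => /(f_sep _ (rA i)).
    by rewrite !rE => /enum_val_inj.
  by rewrite -[delta_mx _ _](scalerK fj_neq0) -fE memvZ // memv_img ?memvf.
rewrite /hilbert_function kerE.
have := limg_ker_dim ev fullv; rewrite capfv ev_full => <-.
by rewrite addKn dimvf /dim /= mul1n.
Qed.

End Separation.

(** * Forms of degree d on torus points that satisfy cycle relations *)

Section CycleRelations.
Local Open Scope ring_scope.
Variables (K : finFieldType) (s M m : nat) (P Q : 'I_m -> {set 'I_s}).
Variable (k : 'I_m -> nat).
Hypothesis cardK : #|K| = M.+2.
Hypotheses (disjPQ : forall j, [disjoint P j & Q j]).
Hypotheses (cardP : forall j, #|P j| = k j) (cardQ : forall j, #|Q j| = k j).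
Hypothesis (disjC : forall j j', j != j' ->
  [disjoint P j :|: Q j & P j' :|: Q j']).
Variable A : {set 'rV[K]_s}.
Hypothesis A_neq0 : forall v, v \in A -> forall i, v 0 i != 0.
Hypothesis A_cycle : forall v, v \in A -> forall j,
  \prod_(i in P j) v 0 i = \prod_(i in Q j) v 0 i.
Variables (i0 : 'I_s) (d : nat).
Hypothesis le_d : ((s - \sum_j k j) * M <= d + M)%N.

Let expK (x : K) : x != 0 -> x ^+ M.+1 = 1.
Proof.
by move=> x_neq0; apply: (mulfI x_neq0); rewrite -exprS -cardK expf_card mulr1.
Qed.

(** By linearity only monomials matter: exponents of the ratios reduce modulo q - 1,
    [exponent_reduction] brings their total off [i0] to at most d, and a power of the variable [i0]
    fills up the degree. *)
Lemma homogenize_on_torus (p : {mpoly K[s]}) :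
  exists2 f : {mpoly K[s]}, f \is d.-homog & forall v, v \in A ->
    f.@[v 0] = v 0 i0 ^+ d * p.@[fun i => v 0 i / v 0 i0].
Proof.
elim/mpolyind: p => [|c a p _ _ [f f_homog fE]].
  by exists 0 => [|v _]; rewrite ?rpred0 // !meval0 mulr0.
have [b le_b bE] := exponent_reduction disjPQ cardP cardQ disjC
  (fun i => inZp (a i) : 'I_M.+1) i0.
(* The spare M in [le_d] cancels against that of the reduced bound, with no subtraction that could
   truncate. *)
have {}le_b : (\sum_(i | i != i0) b i <= d)%N.
  by rewrite -(leq_add2r M); apply: leq_trans le_b _; rewrite card_ord.
pose b' := [multinom if i == i0 then d - \sum_(i | i != i0) b i else b i | i < s]%N.
have b'E : (\sum_(i | i != i0) b' i = \sum_(i | i != i0) b i)%N.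
  by apply: eq_bigr => i /negPf ni; rewrite mnmE ni.
exists (c *: 'X_[b'] + f) => [|v vA].
  rewrite rpredD ?rpredZ // dhomogX /= mdegE (bigD1 i0) //= b'E.
  by rewrite mnmE eqxx subnK.
rewrite !mevalD !mevalZ fE // mulrDr; congr (_ + _); rewrite mulrCA; congr (_ * _).
rewrite !mevalX; have v0 := A_neq0 vA; pose w i := v 0 i / v 0 i0.
have w_unit i : w i ^+ M.+1 = 1 by rewrite expK // mulf_neq0 ?invr_neq0.
have -> : \prod_i w i ^+ a i = \prod_i w i ^+ b i.
  rewrite bE // => [|j]; first by apply: eq_bigr => i _; rewrite expr_mod.
  (* [P j] and [Q j] have equal size, so dividing by the coordinate [i0] preserves the cycle
     relation. *)
  by rewrite !prodf_div !prodr_const cardP cardQ A_cycle.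
rewrite (bigD1 i0) //= [in RHS](bigD1 i0) //= /w divff // expr1n mul1r.
rewrite mnmE eqxx -{2}(subnK le_b) exprD -mulrA; congr (_ * _).
rewrite -prodrXr -big_split /=; apply: eq_bigr => i /negPf ni.
by rewrite mnmE ni -exprMn mulrC divfK.
Qed.

Lemma cycle_relations_separated : separated_by_forms A d.
Proof.
move=> v vA.
pose w i := v 0 i / v 0 i0.
(* Indicator of the ratios of [v]: on K, x^(q-1) is 0 at 0 and 1 elsewhere. *)
have [f f_homog fE] :=
  homogenize_on_torus (\prod_i (1 - ('X_i - (w i)%:MP) ^+ M.+1)).
exists f => //; have peval (x : 'I_s -> K) :
    (\prod_i (1 - ('X_i - (w i)%:MP) ^+ M.+1)).@[x] =
    \prod_i (1 - (x i - w i) ^+ M.+1).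
  rewrite rmorph_prod; apply: eq_bigr => i _ /=.
  by rewrite mevalB meval1 rmorphXn /= mevalB mevalXU mevalC.
split=> [|u uA].
  rewrite fE // peval mulf_neq0 ?expf_neq0 ?A_neq0 //.
  by apply/prodf_neq0 => i _; rewrite subrr expr0n subr0 oner_neq0.
rewrite fE // peval mulf_eq0 negb_or => /andP[_ /prodf_neq0 p_neq0].
have -> : u = (u 0 i0 / v 0 i0) *: v.
  apply/rowP => i; rewrite mxE mulrAC -mulrA -/(w i).
  have [<-|ne_w] := eqVneq (u 0 i / u 0 i0) (w i); first by rewrite mulrC divfK ?A_neq0.
  by have := p_neq0 i isT; rewrite expK ?subrr ?eqxx // subr_eq0.
by rewrite proj_pointZ // mulf_neq0 ?invr_neq0 ?A_neq0.
Qed.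

End CycleRelations.

(** * Alternating edge classes of an even cycle *)

Section CycleEdges.
Local Open Scope ring_scope.

(** Along a closed walk of even length, each position lies on one edge of each parity, so both sides
    are the product of y over one period. *)
Lemma prod_even_odd_cyclic (R : comNzRingType) k (y : nat -> R) : y (2 * k)%N = y 0%N ->
  \prod_(i < k) (y (2 * i)%N * y (2 * i).+1) =
  \prod_(i < k) (y (2 * i).+1 * y (2 * i).+2).
Proof.
move=> y_per; rewrite !big_split /= mulrC; congr (_ * _).
rewrite -(big_mkord xpredT (fun i => y (2 * i)%N)).
rewrite -(big_mkord xpredT (fun i => y (2 * i).+2)).
case: k y_per => [|k] y_per; first by rewrite !big_geq.
rewrite big_nat_recl // big_nat_recr //= mulrC -y_per mulnS.
by congr (_ * _); apply: eq_bigr => i _; rewrite mulnS.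
Qed.

(** The classes are the edges at even and at odd positions of a walk around the cycle. *)
Lemma even_cycle_edge_classes (G : sgraph) s (e : 'I_s -> {set G})
    (he : edge_numbering e) (H : subgraph G) k :
  (2 <= k)%N -> sgraph_iso H (cycle_graph (2 * k)) ->
  exists PQ : {set 'I_s} * {set 'I_s},
    [/\ [disjoint PQ.1 & PQ.2], #|PQ.1| = k, #|PQ.2| = k,
        forall i, i \in PQ.1 :|: PQ.2 -> e i \in sub_edges H &
        forall (R : comNzRingType) (x : G -> R),
          \prod_(i in PQ.1) \prod_(v in e i) x v =
          \prod_(i in PQ.2) \prod_(v in e i) x v].
Proof.
move=> k_ge2 [f [g fK gK] f_adj].
have k2_gt0 : (0 < 2 * k)%N by lia.
(* Reducing n modulo 2k makes the walk periodic, so the closing edge needs no separate case. *)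
pose w n : G := val (g (Ordinal (ltn_pmod n k2_gt0))).
pose edge n := [set w n; w n.+1].
have w_inj a b : w a = w b -> a = b %[mod 2 * k].
  by move/val_inj/(can_inj gK)/(congr1 val).
have w_next a : w a != w a.+1.
  by apply/eqP => /w_inj /eqP; rewrite -[a.+1]addn1 -{1}[a]addn0 eqn_modDl !modn_small //; lia.
have edgeH n : edge n \in sub_edges H.
  set x := g (Ordinal (ltn_pmod n k2_gt0)).
  set y := g (Ordinal (ltn_pmod n.+1 k2_gt0)).
  change (@adj H x y); rewrite -f_adj !gK /= /cycle_adj -!val_eqE /=.
  have <- : (n.+1 %% (2 * k) = (n %% (2 * k)).+1 %% (2 * k))%N.
    by rewrite -addn1 -modnDml addn1.
  rewrite eqxx andbT; apply: contraNneq (w_next n) => eq_n.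
  by apply/eqP; congr (val (g _)); apply: val_inj.
have edge_inj a b : edge a = edge b -> (a < 2 * k -> b < 2 * k -> a = b)%N.
  move=> eq_ab lt_a lt_b; have small n (lt_n : (n < 2 * k)%N) := modn_small lt_n.
  have : w a \in edge b by rewrite -eq_ab set21.
  case/set2P => /w_inj; first by rewrite !small.
  move=> eq_a; have : w b \in edge a by rewrite eq_ab set21.
  case/set2P => /w_inj; first by rewrite !small // => ->.
  (* The edge would be traversed in opposite directions, giving a = a + 2 modulo 2k, impossible as
     2k >= 4. *)
  move=> eq_b; exfalso.
  have /eqP : a = a + 2 %[mod 2 * k].
    by rewrite eq_a addn2 -addn1 -modnDml eq_b modnDml addn1.
  by rewrite -{1}[a]addn0 eqn_modDl !modn_small //; lia.
have /fin_all_exists[c cE] (n : 'I_(2 * k)) : exists i, e i = edge n.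
  have : edge n \in edges G := subsetP (sub_edges_edges H) _ (edgeH n).
  by rewrite -he.2 => /imsetP[i _ ->]; exists i.
have c_inj : injective c.
  move=> a b eq_c; have eq_ab : edge a = edge b by rewrite -!cE eq_c.
  exact/val_inj/(edge_inj _ _ eq_ab).
have lt0 (i : 'I_k) : (2 * i < 2 * k)%N by rewrite ltn_pmul2l.
have lt1 (i : 'I_k) : ((2 * i).+1 < 2 * k)%N by have := ltn_ord i; lia.
pose c0 i := c (Ordinal (lt0 i)); pose c1 i := c (Ordinal (lt1 i)).
have c0_inj : injective c0.
  by move=> a b /c_inj/(congr1 val) /= /eqP; rewrite eqn_pmul2l // => /eqP /val_inj.
have c1_inj : injective c1.
  by move=> a b /c_inj/(congr1 val) /= [] /eqP; rewrite eqn_pmul2l // => /eqP /val_inj.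
exists ([set c0 i | i in 'I_k], [set c1 i | i in 'I_k]); split=> /=.
- rewrite disjoint_subset; apply/subsetP => _ /imsetP[a _ ->]; rewrite inE.
  apply/imsetP => -[b _ /c_inj/(congr1 val)] /= eq_ab.
  by have := congr1 odd eq_ab; rewrite /= !oddM.
- by rewrite card_imset ?card_ord.
- by rewrite card_imset ?card_ord.
- by move=> i /setUP[] /imsetP[a _ ->]; rewrite cE.
move=> R x; rewrite !big_imset /=; try by apply: in2W.
have edge_prod n : \prod_(v in edge n) x v = x (w n) * x (w n.+1).
  by rewrite big_setU1 ?big_set1 // inE.
under eq_bigr => i _ do rewrite cE edge_prod.
under [RHS]eq_bigr => i _ do rewrite cE edge_prod.
apply: (@prod_even_odd_cyclic _ _ (fun n => x (w n))).
by congr (x (val (g _))); apply: val_inj; rewrite /= modnn mod0n.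
Qed.
End CycleEdges.

(** * The regularity bound for the toric set *)

Lemma least_regularity (K : finFieldType) s (X : {set {set 'rV[K]_s}}) l :
  agrees_from X l -> exists2 r, is_regularity X r & r <= l.
Proof.
move=> X_l; have ex_l : exists l, boolp.asbool (agrees_from X l).
  by exists l; apply/boolp.asboolP.
case: (ex_minnP ex_l) => r /boolp.asboolP X_r min_r.
exists r; last exact/min_r/boolp.asboolP.
by split=> // l' X_l'; exact/min_r/boolp.asboolP.
Qed.

Theorem theorem6p3
  (K : finFieldType) (hK : (2 < #|K|)%N)
  (G : sgraph) (hG : no_isolated_vertex G) (hbip : bipartite G)
  (s : nat) (hs : (2 <= s)%N)
  (e : 'I_s -> {set G}) (he : edge_numbering e)
  (m : nat) (k : 'I_m -> nat) (hk : forall i, (2 <= k i)%N)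
  (H : 'I_m -> subgraph G)
  (hH : forall i, sgraph_iso (H i) (cycle_graph (2 * k i)))
  (hdisj : forall i j, i != j ->
    [disjoint sub_edges (H i) & sub_edges (H j)]) :
  exists2 r : nat, is_regularity (toric_set K e) r &
    (r%:Z <= (#|K|%:Z - 2) * (s%:Z - (\sum_(i < m) (k i)%:Z) - 1))%R.
Proof.
pose M := (#|K| - 2)%N; have cardK : #|K| = M.+2 by rewrite /M; lia.
have [PQ PQ_P] := fin_all_exists (fun j => even_cycle_edge_classes he (hk j) (hH j)).
pose P j := (PQ j).1; pose Q j := (PQ j).2.
have disjPQ j : [disjoint P j & Q j] by case: (PQ_P j).
have cardP j : #|P j| = k j by case: (PQ_P j).
have cardQ j : #|Q j| = k j by case: (PQ_P j).
have PQ_H j i : i \in P j :|: Q j -> e i \in sub_edges (H j).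
  by case: (PQ_P j) => _ _ _ + _; apply.
have disjC j j' : j != j' -> [disjoint P j :|: Q j & P j' :|: Q j'].
  move/hdisj => disjH; apply/pred0P => i; apply/andP => -[/PQ_H iH /PQ_H].
  by rewrite (disjointFr disjH iH).
pose A := [set edge_monomial_vector e x | x : {ffun G -> K} & [forall v, x v != 0%R]].
have A_neq0 v : v \in A -> forall i, (v 0 i != 0)%R.
  case/imsetP => x; rewrite inE => /forallP x_neq0 -> i.
  by rewrite mxE; apply/prodf_neq0 => ? _.
have A_cycle v : v \in A -> forall j,
    (\prod_(i in P j) v 0 i = \prod_(i in Q j) v 0 i)%R.
  case/imsetP => x _ -> j; case: (PQ_P j) => _ _ _ _ /(_ K x) xPQ.
  under eq_bigr => i _ do rewrite mxE; rewrite xPQ.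
  by under [RHS]eq_bigr => i _ do rewrite mxE.
have toricE : toric_set K e = [set proj_point v | v in A].
  by rewrite /A -imset_comp.
pose i0 : 'I_s := Ordinal (ltnW hs).
have le_k : ((\sum_j k j).*2 <= s)%N.
  by have := cycles_card_le disjPQ cardP cardQ disjC; rewrite card_ord.
have agree : agrees_from (toric_set K e) (M * (s - \sum_j k j - 1)).
  move=> d le_d; rewrite toricE; apply: hilbert_function_separated.
  apply: (cycle_relations_separated cardK disjPQ cardP cardQ disjC A_neq0 A_cycle i0).
  by nia.
have [r r_reg le_r] := least_regularity agree.
exists r => //; rewrite -(big_morph Posz PoszD (erefl _)) cardK.
move: (\sum_j k j) le_k le_r => n le_n le_r.
have -> : (M.+2%:Z - 2 = M%:Z)%R by lia.
(* From 2n <= s and s >= 2 follows n + 1 <= s, so the natural subtractions are exact. *)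
have -> : (s%:Z - n%:Z - 1 = (s - n - 1)%N%:Z)%R by lia.
by rewrite -PoszM lez_nat.
Qed.
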